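(* If $G$ is a finite nilpotent group of order $n$, then $$c(G)=\sum_{d\mid n}\frac{B_G(d)}{d},$$ where the sum is over all positive divisors $d$ of $n$.
   Context: For a finite group $G$, $c(G)$ denotes the number of cyclic subgroups of $G$ (including the trivial one). For a divisor $d$ of $|G|$, $B_G(d)$ is the number of elements $g\in G$ such that $g^d=1$. *)

(* Defs.v *)
From mathcomp Require Import all_boot all_order all_fingroup all_solvable all_algebra.

Set Implicit Arguments.
Unset Strict Implicit.
Unset Printing Implicit Defensive.

Local Open Scope group_scope.

Definition num_cyclic_subgroups (gT : finGroupType) (G : {group gT}) : nat :=
  #|[set H in subgroups G | cyclic H]|.

Definition num_Ldiv (gT : finGroupType) (G : {group gT}) (d : nat) : nat :=
  #|'Ldiv_d(G)|.

(* Main.v *)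
Require Import Defs.
From mathcomp Require Import all_boot all_order all_fingroup all_solvable all_algebra.
From mathcomp Require classfun.
From mathcomp Require Import ring.

Set Implicit Arguments.
Unset Strict Implicit.
Unset Printing Implicit Defensive.

Import GRing.Theory Num.Theory.

(** Each cyclic subgroup of order m has phi(m) generators, so c(G) is the sum
    over g in G of 1 / phi(#[g]) ([num_cyclic_subgroups_sum]).  Since g is
    counted in B_G(d) exactly when #[g] divides d, exchanging summations turns
    the other side into the sum over g of
      sum_(d %| #|G|, #[g] %| d) 1 / d
    ([num_Ldiv_sum]).  The theorem thus compares two sums over G of functions
    of #[g], although the summands themselves differ.

    Both summands are multiplicative along coprime direct products, so a
    nilpotent group reduces by induction to its Sylow subgroups
    ([sum_order_dprod]).  In a group of order p ^ m, a geometric series shows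
    that the second summand at an element of order p ^ k exceeds the first by
      [k = 0] / (p - 1) - 1 / (p ^ m (p - 1)).
    Only the identity has k = 0, so over the p ^ m elements of the group the
    positive corrections add up to 1 / (p - 1), and so do the negative ones:
    they cancel. *)

Local Open Scope ring_scope.

(** * Divisors *)

Lemma perm_divisors_coprimeM a b : (0 < a)%N -> (0 < b)%N -> coprime a b ->
  perm_eq (divisors (a * b)) [seq (x * y)%N | x <- divisors a, y <- divisors b].
Proof.
move=> a0 b0 co_ab; have ab0 : (0 < a * b)%N by rewrite muln_gt0 a0.
apply: uniq_perm; first exact: divisors_uniq.
  apply: allpairs_uniq; try exact: divisors_uniq.
  (* The factors of x * y are recovered as its gcds with a and with b. *)
  have gcdK x y : x \in divisors a -> y \in divisors b ->
      gcdn a (x * y) = x /\ gcdn b (x * y) = y.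
    rewrite -!dvdn_divisors // => xa yb; split.
      rewrite Gauss_gcdl ?(coprime_dvdr yb) //.
      exact/gcdn_idPr.
    rewrite Gauss_gcdr; first exact/gcdn_idPr.
    by rewrite coprime_sym (coprime_dvdl xa).
  move=> u v /allpairsP[[x y] /= [xa yb ->]] /allpairsP[[z t] /= [za tb ->]] /= e.
  have [ex ey] := gcdK _ _ xa yb; have [ez et] := gcdK _ _ za tb.
  by congr pair; [rewrite -ex e | rewrite -ey e].
move=> d; rewrite -dvdn_divisors //; apply/idP/allpairsP => [d_ab|].
  exists (gcdn d a, gcdn d b); rewrite -!dvdn_divisors //= !dvdn_gcdr.
  split=> //; apply/eqP; rewrite eqn_dvd; apply/andP; split.
    rewrite muln_gcdl !muln_gcdr !dvdn_gcd d_ab.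
    by rewrite !(dvdn_mulr _ (dvdnn d)) (dvdn_mull _ (dvdnn d)).
  rewrite Gauss_dvd ?dvdn_gcdl //.
  exact: coprime_dvdl (dvdn_gcdr _ _) (coprime_dvdr (dvdn_gcdr _ _) co_ab).
case=> -[x y] /= []; rewrite -!dvdn_divisors // => xa yb ->.
exact: dvdn_mul.
Qed.

Lemma perm_divisors_pfactor p m : prime p ->
  perm_eq (divisors (p ^ m)) [seq (p ^ i)%N | i <- iota 0 m.+1].
Proof.
move=> pr_p; apply: uniq_perm; first exact: divisors_uniq.
  by rewrite map_inj_uniq ?iota_uniq //; apply: expnI; apply: prime_gt1.
move=> d; rewrite -dvdn_divisors ?expn_gt0 ?prime_gt0 //.
apply/(dvdn_pfactor _ _ pr_p)/mapP => -[i le_im ->]; exists i => //.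
  by rewrite mem_iota.
by move: le_im; rewrite mem_iota.
Qed.

(** The weight that an element of order o carries in the sum of B_G(d) / d,
    when G has order n. *)
Definition inv_multiples_sum (n o : nat) : rat :=
  \sum_(d <- divisors n | (o %| d)%N) d%:R^-1.

Lemma inv_multiples_sum_coprimeM a b o1 o2 :
    (0 < a)%N -> (0 < b)%N -> coprime a b -> (o1 %| a)%N -> (o2 %| b)%N ->
  inv_multiples_sum (a * b) (o1 * o2) =
    inv_multiples_sum a o1 * inv_multiples_sum b o2.
Proof.
move=> a0 b0 co_ab o1a o2b; rewrite /inv_multiples_sum big_mkcond /=.
rewrite (perm_big _ (perm_divisors_coprimeM a0 b0 co_ab)) /= big_allpairs_dep.
rewrite [X in X * _]big_mkcond [X in _ * X]big_mkcond /= mulr_suml.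
apply: eq_big_seq => x; rewrite -dvdn_divisors // => xa.
rewrite mulr_sumr; apply: eq_big_seq => y; rewrite -dvdn_divisors // => yb.
have -> : (o1 * o2 %| x * y)%N = (o1 %| x)%N && (o2 %| y)%N.
  rewrite Gauss_dvd ?(coprime_dvdl o1a) ?(coprime_dvdr o2b) //.
  rewrite Gauss_dvdl ?(coprime_dvdl o1a) ?(coprime_dvdr yb) //.
  rewrite Gauss_dvdr // coprime_sym.
  by rewrite (coprime_dvdl xa) ?(coprime_dvdr o2b).
case: (o1 %| x)%N; case: (o2 %| y)%N; rewrite ?mulr0 ?mul0r //=.
by rewrite natrM invfM.
Qed.

(** The sum is the geometric series of the p ^- i with k <= i <= m.  Its value is
    (p / p ^ k - 1 / p ^ m) / (p - 1), and p / (p ^ k (p - 1)) is the inverse of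
    totient (p ^ k) for 0 < k, but is 1 + 1 / (p - 1) for k = 0. *)
Lemma inv_multiples_sum_pfactor p m k : prime p -> (k <= m)%N ->
  inv_multiples_sum (p ^ m) (p ^ k) =
    (totient (p ^ k))%:R^-1 + (k == 0)%:R / (p%:R - 1)
    - ((p ^ m)%:R * (p%:R - 1))^-1.
Proof.
move=> pr_p le_km; have p_gt1 := prime_gt1 pr_p.
have p0 : p%:R != 0 :> rat by rewrite pnatr_eq0 -lt0n prime_gt0.
have p1 : p%:R - 1 != 0 :> rat by rewrite subr_eq0 (eqr_nat _ p 1) gtn_eqF.
rewrite /inv_multiples_sum (perm_big _ (perm_divisors_pfactor m pr_p)) big_map.
rewrite (eq_bigl (fun i => (k <= i)%N)) => [|i]; last by rewrite dvdn_Pexp2l.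
have -> : \sum_(i <- iota 0 m.+1 | (k <= i)%N) (p ^ i)%:R^-1
        = \sum_(k <= i < m.+1) (p ^ i)%:R^-1 :> rat.
  by rewrite (big_nat_widenl k 0) // /index_iota subn0.
(* A discrete antiderivative of the summand, so that the series telescopes. *)
pose f i : rat := - (p%:R / ((p ^ i)%:R * (p%:R - 1))).
rewrite (eq_bigr (fun i => f i.+1 - f i)) => [|i _]; last first.
  rewrite /f expnS natrM natrX; field.
  by rewrite p0 p1 expf_neq0.
rewrite telescope_sumr ?leqW // /f expnS natrM.
have pX i : (p ^ i)%:R != 0 :> rat by rewrite natrX expf_neq0.
case: k le_km => [|k] _; rewrite /= ?expn0.
  rewrite (_ : totient 1 = 1%N) //; field.
  by rewrite p0 p1 pX.
rewrite totient_pfactor //= natrM expnS natrM -subn1 natrB ?prime_gt0 //.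
field.
by rewrite p0 p1 !pX.
Qed.

(** * Sums over the elements of a group *)

Section GroupSums.
Variable gT : finGroupType.
Implicit Types G H K : {group gT}.

Lemma num_cyclic_subgroups_sum G :
  (num_cyclic_subgroups G)%:R = \sum_(g in G) (totient #[g]%g)%:R^-1 :> rat.
Proof.
rewrite (partition_big (fun g => <[g]>%G)
           [in [set H in subgroups G | cyclic H]]) /=; last first.
  by move=> g Gg; rewrite !inE cycle_subG Gg cycle_cyclic.
rewrite /num_cyclic_subgroups -sum1_card natr_sum; apply: eq_bigr => H.
rewrite !inE => /andP[sHG /cyclicP[a defH]].
have phi0 : (totient #[a]%g)%:R != 0 :> rat.
  by rewrite pnatr_eq0 -lt0n totient_gt0 order_gt0.
rewrite (eq_bigr (fun _ => (totient #[a]%g)%:R^-1)); last first.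
  move=> g /andP[_ /eqP defg].
  by rewrite /order -[<[g]>%g]/(gval <[g]>%G) defg defH.
rewrite (eq_bigl [in [set x | generator <[a]>%g x]]).
  by rewrite sumr_const -totient_gen -[RHS]mulr_natr mulVf.
move=> g; rewrite !inE /generator -val_eqE /= defH eq_sym andb_idl //.
by move=> /eqP defg; rewrite -cycle_subG -defg -defH.
Qed.

Lemma num_Ldiv_sum G :
  \sum_(d <- divisors #|G|) (num_Ldiv G d)%:R / d%:R =
    \sum_(g in G) inv_multiples_sum #|G| #[g]%g.
Proof.
rewrite /inv_multiples_sum (exchange_big_dep xpredT) //=; apply: eq_bigr => d _.
rewrite sumr_const mulrC mulr_natr /num_Ldiv; congr (_ *+ _).
by apply: eq_card => g; rewrite !inE -order_dvdn.
Qed.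

(** Orders multiply along a coprime direct product, so a multiplicative function
    of the order factors as a product over the two components. *)
Lemma sum_order_dprod (R : comNzRingType) K H G (F F1 F2 : nat -> R) :
    (K \x H = G)%g -> coprime #|K| #|H| ->
    (forall a b, (a %| #|K|)%N -> (b %| #|H|)%N -> F (a * b)%N = F1 a * F2 b) ->
  \sum_(g in G) F #[g]%g =
    (\sum_(x in K) F1 #[x]%g) * \sum_(y in H) F2 #[y]%g.
Proof.
move=> defG coKH FM; rewrite (classfun.reindex_dprod defG) /= mulr_suml.
apply: eq_bigr => x Kx; rewrite mulr_sumr; apply: eq_bigr => y Hy.
rewrite orderM ?FM ?order_dvdG //.
  by have [_ _ cHK _] := dprodP defG; apply/commute_sym/(centsP cHK).
exact: coprime_dvdl (order_dvdG Kx) (coprime_dvdr (order_dvdG Hy) coKH).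
Qed.

(** The terms of [inv_multiples_sum_pfactor] that do not come from the totient
    cancel over the group: 1 / (p - 1) is contributed by the identity alone, and
    1 / (p ^ m (p - 1)) is subtracted by each of the p ^ m elements. *)
Lemma pgroup_inv_multiples_sum p G : prime p -> (p.-group G)%g ->
  \sum_(g in G) inv_multiples_sum #|G| #[g]%g =
    \sum_(g in G) (totient #[g]%g)%:R^-1.
Proof.
move=> pr_p pG; have [m oG] := p_natP pG.
have p1 : p%:R - 1 != 0 :> rat.
  by rewrite subr_eq0 (eqr_nat _ p 1) gtn_eqF ?prime_gt1.
have pm0 : (p ^ m)%:R != 0 :> rat.
  by rewrite pnatr_eq0 -lt0n expn_gt0 prime_gt0.
rewrite (eq_bigr (fun g => (totient #[g]%g)%:R^-1 +
    ((g == 1%g)%:R / (p%:R - 1) - ((p ^ m)%:R * (p%:R - 1))^-1))).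
  have one_identity : \sum_(g in G) (g == 1%g)%:R = 1 :> rat.
    rewrite (bigD1 1%g) ?group1 //= eqxx big1 ?addr0 // => g.
    by case/andP=> _ /negPf->.
  rewrite big_split /= sumrB -mulr_suml one_identity sumr_const oG -mulr_natr.
  field.
  by rewrite p1 pm0.
move=> g Gg; have := order_dvdG Gg; rewrite oG.
case/(dvdn_pfactor _ _ pr_p) => k le_km og.
rewrite -order_eq1 og inv_multiples_sum_pfactor // addrA.
by rewrite -[(p ^ k == 1)%N]/(p ^ k == p ^ 0)%N eqn_exp2l ?prime_gt1.
Qed.

(** The p-core and the p'-core of a nilpotent group are direct factors of
    coprime orders, and the second one is smaller when p divides the order. *)
Lemma nilpotent_inv_multiples_sum G : nilpotent G ->
  \sum_(g in G) inv_multiples_sum #|G| #[g]%g =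
    \sum_(g in G) (totient #[g]%g)%:R^-1.
Proof.
have [n] := ubnP #|G|; elim: n G => // n IHn G ltGn nilG.
have [G1 | ntG] := eqVneq (gval G) 1%g.
  have pG1 : (2.-group G)%g by rewrite G1 pgroup1.
  exact: (pgroup_inv_multiples_sum (p := 2)).
have pr_p : prime (pdiv #|G|) by rewrite pdiv_prime // cardG_gt1.
set p := pdiv #|G| in pr_p; pose P := 'O_p(G)%G; pose H := 'O_p^'(G)%G.
have defG : (P \x H = G)%g := nilpotent_pcoreC p nilG.
have coPH : coprime #|P| #|H|.
  exact: pnat_coprime (pcore_pgroup p G) (pcore_pgroup p^' G).
have oG : #|G| = (#|P| * #|H|)%N by rewrite (dprod_card defG).
have ltHn : (#|H| < n)%N.
  apply: leq_trans (_ : #|G| <= n)%N; last by [].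
  apply: proper_card; rewrite properEneq pcore_sub andbT.
  apply/negP => /eqP eqHG; have := pcore_pgroup p^' G; rewrite eqHG /pgroup.
  by rewrite p'natE // pdiv_dvd.
rewrite oG (sum_order_dprod defG coPH (fun a b => inv_multiples_sum_coprimeM
  (cardG_gt0 P) (cardG_gt0 H) coPH)).
rewrite (pgroup_inv_multiples_sum pr_p) ?pcore_pgroup //.
rewrite IHn ?(nilpotentS (pcore_sub _ _)) //.
pose F o : rat := (totient o)%:R^-1.
apply/esym; apply: (sum_order_dprod (F := F) (F1 := F) (F2 := F) defG coPH).
move=> a b aP bH; rewrite /F.
rewrite totient_coprime ?natrM ?invfM //.
exact: coprime_dvdl aP (coprime_dvdr bH coPH).
Qed.

End GroupSums.

Theorem theorem2 (gT : finGroupType) (G : {group gT}) (n : nat)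
    (nilG : nilpotent G) (oG : #|G| = n) :
  (num_cyclic_subgroups G)%:R =
    \sum_(d <- divisors n) (num_Ldiv G d)%:R / d%:R :> rat.
Proof.
rewrite -oG num_Ldiv_sum nilpotent_inv_multiples_sum //.
exact: num_cyclic_subgroups_sum.
Qed.
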